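(* Let $T$ be a theory and $\alpha$ a formula over $\mathbf{MMTL}$. Then the following statements are equivalent: (1) $T\vdash \alpha$; (2) for each UMTL-algebra $(L,\forall)$ and for every model $e$ of $T$ in $(L,\forall)$, $e(\alpha)=1$; (3) $[\alpha]_T=[\overline{1}]_T$.
   Context: Formulas are built from propositional variables with the binary connectives $\&,\Rightarrow,\sqcap$, the constant $\overline{0}$ and the unary connective $\square$. Abbreviations: $\overline{1}=\alpha\Rightarrow\alpha$, $\neg\alpha=\alpha\Rightarrow\overline{0}$, $\alpha\sqcup\beta=((\alpha\Rightarrow\beta)\Rightarrow\beta)\sqcap((\beta\Rightarrow\alpha)\Rightarrow\alpha)$, and $\alpha\Leftrightarrow\beta$ (also written $\alpha\equiv\beta$) is $(\alpha\Rightarrow\beta)\&(\beta\Rightarrow\alpha)$. The logic $\mathbf{MMTL}$ has the axioms of $\mathbf{MTL}$: $(\alpha\Rightarrow \beta)\Rightarrow((\beta\Rightarrow\gamma)\Rightarrow(\alpha\Rightarrow\gamma))$; $(\alpha\&\beta)\Rightarrow \alpha$; $(\alpha\&\beta)\Rightarrow(\beta\&\alpha)$; $(\alpha\sqcap \beta)\Rightarrow \alpha$; $(\alpha\sqcap \beta)\Rightarrow (\beta\sqcap \alpha)$; $(\alpha\&(\alpha\Rightarrow \beta))\Rightarrow(\alpha\sqcap\beta)$; $(\alpha\Rightarrow(\beta\Rightarrow\gamma))\Rightarrow((\alpha\&\beta)\Rightarrow\gamma)$; $((\alpha\&\beta)\Rightarrow\gamma)\Rightarrow(\alpha\Rightarrow(\beta\Rightarrow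 \gamma))$; $((\alpha\Rightarrow\beta)\Rightarrow\gamma)\Rightarrow(((\beta\Rightarrow \alpha)\Rightarrow \gamma)\Rightarrow \gamma)$; $\overline{0}\Rightarrow\alpha$; together with the schemes (M1) $\square \alpha\Rightarrow \alpha$; (M2) $\square((\alpha\Rightarrow \square\beta) \Rightarrow \square\beta)\equiv ((\square \alpha\Rightarrow \square \beta)\Rightarrow \square \beta)$; (M3) $\square(\square\alpha\Rightarrow \beta)\equiv (\square \alpha\Rightarrow \square \beta)$; and the rules Modus Ponens ($\alpha,\alpha\Rightarrow\beta\vdash\beta$) and Necessitation ($\alpha/\square\alpha$). A theory $T$ is a set of formulas; $T\vdash\alpha$ means there is a finite sequence of formulas ending in $\alpha$, each of which is an axiom, a member of $T$, or follows from earlier ones by Modus Ponens or Necessitation. An MTL-algebra is a structure $(L,\wedge,\vee,\odot,\rightarrow,0,1)$ such that $(L,\wedge,\vee,0,1)$ is a bounded lattice, $(L,\odot,1)$ is a commutative monoid, $x\odot y\leq z$ iff $x\leq y\rightarrow z$, and $(x\rightarrow y)\vee(y\rightarrow x)=1$. A UMTL-algebra is an MTL-algebra with a unary operation $\forall$ satisfying (U1) $\forall x\leq x$; (U2) $\forall((x\rightarrow \forall y)\rightarrow \forall y)=(\forall x\rightarrow \forall y)\rightarrow \forall y$; (U3) $\forall(\forall x\rightarrow y)=\forall x\rightarrow\forall y$. An evaluation $e$ in a UMTL-algebra $(L,\forall)$ maps formulas to $L$, interpreting $\&,\Rightarrow,\sqcap,\overline{0},\square$ as $\odot,\rightarrow,\wedge,0,\forall$.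 It is a model of $T$ if $e(\gamma)=1$ for all $\gamma\in T$. $[\alpha]_T$ denotes the equivalence class of $\alpha$ in the Lindenbaum–Tarski algebra of $\mathbf{MMTL}$ over $T$, i.e. under the relation $\alpha\sim_T\beta$ iff $T\vdash\alpha\Leftrightarrow\beta$. *)

(* Defs.v *)
From HB Require Import structures.
From mathcomp Require Import all_boot all_order.
From mathcomp Require Import all_classical.

Set Implicit Arguments.
Unset Strict Implicit.
Unset Printing Implicit Defensive.

Local Open Scope order_scope.

(* Carriers are choice types, as for every ordered structure of the library;
   with gen_eqMixin and gen_choiceMixin from boolp this covers every type.
   The trivial algebra, in which \bot = \top, is allowed. *)
HB.mixin Record TBLattice_isMTL d L of Order.TBLattice d L := {
  mtl_mul : L -> L -> L;
  mtl_imp : L -> L -> L;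
  mtl_mulA : associative mtl_mul;
  mtl_mulC : commutative mtl_mul;
  mtl_mul1x : left_id (\top : L) mtl_mul;
  mtl_residuation : forall x y z : L,
    (mtl_mul x y <= z) <-> (x <= mtl_imp y z);
  mtl_prelinearity : forall x y : L,
    mtl_imp x y `|` mtl_imp y x = \top
}.

#[short(type="mtlAlgType")]
HB.structure Definition MTLAlgebra d :=
  {L of Order.TBLattice d L & TBLattice_isMTL d L}.

HB.instance Definition _ d (L : mtlAlgType d) :=
  Monoid.isComLaw.Build L \top mtl_mul mtl_mulA mtl_mulC mtl_mul1x.

HB.mixin Record MTL_isUMTL d L of MTLAlgebra d L := {
  umtl_all : L -> L;
  umtl_U1 : forall x : L, umtl_all x <= x;
  umtl_U2 : forall x y : L,
    umtl_all (mtl_imp (mtl_imp x (umtl_all y)) (umtl_all y)) =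
    mtl_imp (mtl_imp (umtl_all x) (umtl_all y)) (umtl_all y);
  umtl_U3 : forall x y : L,
    umtl_all (mtl_imp (umtl_all x) y) = mtl_imp (umtl_all x) (umtl_all y)
}.

#[short(type="umtlAlgType")]
HB.structure Definition UMTLAlgebra d :=
  {L of MTLAlgebra d L & MTL_isUMTL d L}.

(* V is the type of propositional variables. *)
Inductive formula (V : Type) : Type :=
| Var of V
| Conj of formula V & formula V
| Imp of formula V & formula V
| Meet of formula V & formula V
| Zero
| Box of formula V.

Arguments Zero {V}.

HB.instance Definition _ (V : Type) := gen_eqMixin (formula V).
HB.instance Definition _ (V : Type) := gen_choiceMixin (formula V).

Declare Scope formula_scope.
Delimit Scope formula_scope with F.
Bind Scope formula_scope with formula.
Notation "a &* b" := (Conj a b) (at level 40, left associativity)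
  : formula_scope.
Notation "a ==> b" := (Imp a b) : formula_scope.
Notation "a `&` b" := (Meet a b) : formula_scope.

Definition Iff (V : Type) (a b : formula V) : formula V :=
  ((a ==> b) &* (b ==> a))%F.
Notation "a <==> b" := (Iff a b) (at level 70, no associativity)
  : formula_scope.

(* The constant 1 abbreviates a ==> a for an unspecified formula a, which is
   kept here as a parameter. *)
Definition One (V : Type) (a : formula V) : formula V := (a ==> a)%F.

Inductive mmtl_axiom (V : Type) : formula V -> Prop :=
| ax_trans a b c : mmtl_axiom ((a ==> b) ==> ((b ==> c) ==> (a ==> c)))
| ax_conjl a b : mmtl_axiom ((a &* b) ==> a)
| ax_conjC a b : mmtl_axiom ((a &* b) ==> (b &* a))
| ax_meetl a b : mmtl_axiom ((a `&` b) ==> a)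
| ax_meetC a b : mmtl_axiom ((a `&` b) ==> (b `&` a))
| ax_div a b : mmtl_axiom ((a &* (a ==> b)) ==> (a `&` b))
| ax_uncurry a b c : mmtl_axiom ((a ==> (b ==> c)) ==> ((a &* b) ==> c))
| ax_curry a b c : mmtl_axiom (((a &* b) ==> c) ==> (a ==> (b ==> c)))
| ax_prelin a b c :
    mmtl_axiom (((a ==> b) ==> c) ==> (((b ==> a) ==> c) ==> c))
| ax_zero a : mmtl_axiom (Zero ==> a)
| ax_M1 a : mmtl_axiom (Box a ==> a)
| ax_M2 a b :
    mmtl_axiom (Box ((a ==> Box b) ==> Box b)
                  <==> ((Box a ==> Box b) ==> Box b))
| ax_M3 a b :
    mmtl_axiom (Box (Box a ==> b) <==> (Box a ==> Box b)).

Definition theory (V : Type) := set (formula V).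

Section Deduction.
Variables (V : Type) (T : theory V).

Definition justified (s : seq (formula V)) (a : formula V) : Prop :=
  [\/ mmtl_axiom a,
      T a,
      exists2 b, b \in s & (b ==> a)%F \in s
    | exists2 b, b \in s & a = Box b].

Definition is_proof (s : seq (formula V)) : Prop :=
  forall s1 a s2, s = s1 ++ a :: s2 -> justified s1 a.

Definition provable (a : formula V) : Prop :=
  exists s, is_proof (rcons s a).

Definition lt_class (a : formula V) : set (formula V) :=
  [set b | provable (a <==> b)].

End Deduction.

Record is_evaluation (V : Type) d (L : umtlAlgType d) (e : formula V -> L) :
  Prop := {
  eval_conj : forall a b, e (a &* b)%F = mtl_mul (e a) (e b);
  eval_imp : forall a b, e (a ==> b)%F = mtl_imp (e a) (e b);
  eval_meet : forall a b, e (a `&` b)%F = e a `&` e b;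
  eval_zero : e Zero = \bot;
  eval_box : forall a, e (Box a) = umtl_all (e a)
}.

Definition is_model (V : Type) (T : theory V) d (L : umtlAlgType d)
    (e : formula V -> L) : Prop :=
  is_evaluation e /\ (forall c, T c -> e c = \top).

(* Main.v *)
Require Import Defs.
From HB Require Import structures.
From mathcomp Require Import all_boot all_order.
From mathcomp Require Import all_classical.

(** Soundness is an induction on proofs: since [x -> y = 1] iff [x <= y], each
    implicational axiom amounts to an inequality valid in every UMTL-algebra
    and each equivalence to an identity, and the two rules preserve the value
    1, necessitation because [forall 1 = 1] ([umtl_all1]).

    For completeness, the relation [T |- a => b] is a preorder on formulas, and
    the axioms of MTL make it a residuated lattice up to interderivability: [&]
    and [=>] are adjoint by currying ([entails_curry], [entails_uncurry]), and
    prelinearity, used as a case distinction between [a => b] and [b => a]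
    ([provable_cases]), shows that the meet is a greatest lower bound
    ([entails_meet]) and that the defined disjunction is a least upper bound
    ([join_entails]). The box is monotone because (M3) and necessitation turn a
    theorem [box a => b] into [box a => box b] ([entails_box]). So all
    connectives descend to the quotient by interderivability, the Lindenbaum
    algebra; (M1)-(M3) become (U1)-(U3) there, and the quotient map is a model
    of [T] in which a formula has value 1 iff it is a theorem of [T]
    ([pi_is_model], [pi_eq_top]).

    The statement about classes says that [a] and [b => b] are interderivable;
    since [b => b] is a theorem, this is provability of [a]. *)

Set Implicit Arguments.
Unset Strict Implicit.
Unset Printing Implicit Defensive.

Local Open Scope order_scope.
Local Open Scope quotient_scope.
Import Order.Theory.

(** * Provability as an inductive predicate *)

Section Provability.
Variables (V : Type) (T : theory V).
Implicit Types (a b c : formula V) (s : seq (formula V)).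

Lemma justified_sub s1 s2 a :
  {subset s1 <= s2} -> justified T s1 a -> justified T s2 a.
Proof.
move=> s12 [ax|Ta|[b bs bas]|[b bs ->]].
- exact: Or41.
- exact: Or42.
- by apply: Or43; exists b; apply: s12.
- by apply: Or44; exists b => //; apply: s12.
Qed.

Lemma is_proof_rcons s a :
  is_proof T (rcons s a) <-> is_proof T s /\ justified T s a.
Proof.
split=> [pr|[pr ja] s1 b s2].
  split=> [s1 b s2 def_s|]; last by apply: (pr s a [::]); rewrite cats1.
  by apply: (pr s1 b (rcons s2 a)); rewrite def_s rcons_cat.
elim/last_ind: s2 => [|s2 c _]; first by rewrite cats1 => /rcons_inj [<- <-].
by rewrite -rcons_cons -rcons_cat => /rcons_inj [/pr].
Qed.

Lemma is_proof_cat s1 s2 :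
  is_proof T s1 -> is_proof T s2 -> is_proof T (s1 ++ s2).
Proof.
move=> pr1; elim/last_ind: s2 => [|s2 a IHs] pr2; first by rewrite cats0.
have [{}/IHs pr12 ja] := (is_proof_rcons s2 a).1 pr2.
rewrite -rcons_cat; apply/is_proof_rcons; split=> //.
by apply: justified_sub ja => b; rewrite mem_cat orbC => ->.
Qed.

Lemma is_proof_nil : is_proof T [::].
Proof. by case. Qed.

Lemma provable_axiom a : mmtl_axiom a -> provable T a.
Proof.
move=> ax; exists [::]; apply/is_proof_rcons.
by split; [apply: is_proof_nil | apply: Or41].
Qed.

Lemma provable_hyp a : T a -> provable T a.
Proof.
move=> Ta; exists [::]; apply/is_proof_rcons.
by split; [apply: is_proof_nil | apply: Or42].
Qed.

Lemma provable_mp a b :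
  provable T a -> provable T (a ==> b)%F -> provable T b.
Proof.
move=> [s1 pr1] [s2 pr2]; exists (rcons s1 a ++ rcons s2 (a ==> b)%F).
apply/is_proof_rcons; split; first exact: is_proof_cat.
apply: Or43; exists a; first by rewrite mem_cat mem_rcons mem_head.
by rewrite mem_cat orbC mem_rcons mem_head.
Qed.

Lemma provable_nec a : provable T a -> provable T (Box a).
Proof.
move=> [s pr]; exists (rcons s a); apply/is_proof_rcons; split=> //.
by apply: Or44; exists a => //; rewrite mem_rcons mem_head.
Qed.

Lemma provable_induction (P : formula V -> Prop) :
    (forall a, mmtl_axiom a -> P a) -> (forall a, T a -> P a) ->
    (forall a b, P a -> P (a ==> b)%F -> P b) ->
    (forall a, P a -> P (Box a)) ->
  forall a, provable T a -> P a.
Proof.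
move=> Pax Phyp Pmp Pnec a [s pr].
suff all_P t : is_proof T t -> forall b, b \in t -> P b.
  by apply: all_P pr _ _; rewrite mem_rcons mem_head.
elim/last_ind: t => [|t c IHt] //.
move=> /is_proof_rcons [{}/IHt IHt jc] b.
rewrite mem_rcons inE => /predU1P [->|/IHt //].
case: jc => [/Pax //|/Phyp //|[x /IHt Px /IHt]|[x /IHt Px ->]].
- exact: Pmp.
- exact: Pnec.
Qed.

End Provability.

(** * Soundness *)

Section Algebra.
Context {d : Order.disp_t}.

Section MTL.
Variable L : mtlAlgType d.
Implicit Types x y z : L.

Lemma mtl_mul_le x y z : (mtl_mul x y <= z) = (x <= mtl_imp y z).
Proof. by apply/idP/idP => /mtl_residuation. Qed.

Lemma mtl_imp_eq_top x y : mtl_imp x y = \top <-> x <= y.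
Proof.
by rewrite -[x in x <= y]mtl_mul1x mtl_mul_le le1x; split=> [->|/eqP].
Qed.

Lemma mtl_imp_mulr x y z : mtl_imp (mtl_mul x y) z = mtl_imp x (mtl_imp y z).
Proof.
apply/eqP; rewrite eq_le; apply/andP; split.
  by rewrite -!mtl_mul_le -mtl_mulA mtl_mul_le.
by rewrite -mtl_mul_le mtl_mulA !mtl_mul_le.
Qed.

Lemma mtl_mul_le_r x y : mtl_mul x y <= y.
Proof. by rewrite mtl_mul_le (le_trans (lex1 x)) // -mtl_mul_le mtl_mul1x. Qed.

Lemma mtl_mul_le_l x y : mtl_mul x y <= x.
Proof. by rewrite mtl_mulC mtl_mul_le_r. Qed.

Lemma mtl_mul_mono x y x' y' :
  x <= x' -> y <= y' -> mtl_mul x y <= mtl_mul x' y'.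
Proof.
move=> xx' yy'; rewrite mtl_mul_le (le_trans xx') // -mtl_mul_le mtl_mulC.
by rewrite mtl_mul_le (le_trans yy') // -mtl_mul_le mtl_mulC.
Qed.

Lemma mtl_modus_ponens x y : mtl_mul x (mtl_imp x y) <= y.
Proof. by rewrite mtl_mulC mtl_mul_le. Qed.

Lemma mtl_imp_trans x y z : mtl_imp x y <= mtl_imp (mtl_imp y z) (mtl_imp x z).
Proof.
rewrite -!mtl_mul_le mtl_mulC mtl_mulA.
apply: le_trans (mtl_modus_ponens y z).
by apply: mtl_mul_mono; first exact: mtl_modus_ponens.
Qed.

(** As [x -> y] and [y -> x] join to 1, an element above both of them is 1;
    the inequality says that such an element is
    [((x -> y) -> z) * ((y -> x) -> z) -> z], by modus ponens in either case. *)
Lemma mtl_cases x y z :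
  mtl_imp (mtl_imp x y) z <= mtl_imp (mtl_imp (mtl_imp y x) z) z.
Proof.
rewrite -mtl_imp_eq_top -mtl_imp_mulr; apply/eqP.
rewrite -le1x -(mtl_prelinearity x y) leUx; apply/andP; split.
all: rewrite -mtl_mul_le; apply: le_trans (mtl_modus_ponens _ _).
all: apply: mtl_mul_mono => //.
- exact: mtl_mul_le_l.
- exact: mtl_mul_le_r.
Qed.

End MTL.

(** (U3) at [x = y = 1], where [forall 1 -> 1 = 1] and
    [forall 1 -> forall 1 = 1]. *)
Lemma umtl_all1 (L : umtlAlgType d) : umtl_all (\top : L) = \top.
Proof.
have := umtl_U3 (\top : L) \top.
by rewrite ((mtl_imp_eq_top _ _).2 (lex1 _)) ((mtl_imp_eq_top _ _).2 (lexx _)).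
Qed.

Section Soundness.
Variables (V : Type) (T : theory V) (L : umtlAlgType d).
Variable e : formula V -> L.
Hypothesis ev_e : is_evaluation e.

Let evE := (eval_conj ev_e, eval_imp ev_e, eval_meet ev_e, eval_zero ev_e,
  eval_box ev_e).

Lemma eval_imp_eq_top a b : e (a ==> b)%F = \top <-> e a <= e b.
Proof. by rewrite evE mtl_imp_eq_top. Qed.

Lemma eval_iff_eq_top a b : e a = e b -> e (a <==> b)%F = \top.
Proof.
move=> eab; rewrite /Iff eval_conj //.
have [-> ->] : e (a ==> b)%F = \top /\ e (b ==> a)%F = \top.
  by split; apply/eval_imp_eq_top; rewrite eab.
exact: mtl_mul1x.
Qed.

Lemma eval_axiom a : mmtl_axiom a -> e a = \top.
Proof.
case=> {a} *; try apply/eval_imp_eq_top; try apply/eval_iff_eq_top.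
all: rewrite !evE.
- exact: mtl_imp_trans.
- exact: mtl_mul_le_l.
- by rewrite mtl_mulC.
- exact: leIl.
- by rewrite meetC.
- by rewrite lexI mtl_mul_le_l mtl_modus_ponens.
- by rewrite mtl_imp_mulr.
- by rewrite mtl_imp_mulr.
- exact: mtl_cases.
- exact: le0x.
- exact: umtl_U1.
- exact: umtl_U2.
- exact: umtl_U3.
Qed.

Lemma soundness a :
  (forall c, T c -> e c = \top) -> provable T a -> e a = \top.
Proof.
move=> eT; elim/provable_induction => {a} [||a b ea|a ea].
- exact: eval_axiom.
- exact: eT.
- by move=> /eval_imp_eq_top; rewrite ea le1x => /eqP.
- by rewrite eval_box // ea umtl_all1.
Qed.

End Soundness.
End Algebra.

(** * The residuated lattice of formulas *)

Section Entailment.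
Variables (V : Type) (T : theory V).
Implicit Types a b c : formula V.

Definition entails a b := provable T (a ==> b)%F.

Let axE a b : mmtl_axiom (a ==> b)%F -> entails a b.
Proof. exact: provable_axiom. Qed.

Lemma entails_trans b a c : entails a b -> entails b c -> entails a c.
Proof.
move=> ab bc; apply: provable_mp bc _; apply: provable_mp ab _.
exact/provable_axiom/ax_trans.
Qed.

Lemma entails_curry a b c : entails (a &* b) c -> entails a (b ==> c).
Proof. by move=> h; apply: provable_mp h _; apply/axE/ax_curry. Qed.

Lemma entails_uncurry a b c : entails a (b ==> c) -> entails (a &* b) c.
Proof. by move=> h; apply: provable_mp h _; apply/axE/ax_uncurry. Qed.

Lemma entails_conj_l a b : entails (a &* b) a.
Proof. exact/axE/ax_conjl. Qed.

Lemma entails_conjC a b : entails (a &* b) (b &* a).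
Proof. exact/axE/ax_conjC. Qed.

Lemma entails_conj_r a b : entails (a &* b) b.
Proof. exact: entails_trans (entails_conjC a b) (entails_conj_l b a). Qed.

(** Currying [t & a => a] gives [t => (a => a)] for any formula [t]; an axiom
    [t] is then detached. *)
Lemma entails_refl a : entails a a.
Proof.
apply: (@provable_mp _ _ (Zero ==> Zero)%F); first exact/axE/ax_zero.
exact/entails_curry/entails_conj_r.
Qed.
Hint Resolve entails_refl : core.

Lemma entails_provable a b : provable T b -> entails a b.
Proof.
by move=> Tb; apply: provable_mp Tb _; apply/entails_curry/entails_conj_l.
Qed.

Lemma entails_modus_ponens a b : entails (a &* (a ==> b)) b.
Proof. exact/(entails_trans (entails_conjC _ _))/entails_uncurry. Qed.

Lemma entails_conj a b a' b' :
  entails a a' -> entails b b' -> entails (a &* b) (a' &* b').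
Proof.
move=> aa' bb'; apply/entails_uncurry/(entails_trans aa')/entails_curry.
apply: entails_trans (entails_conjC _ _) _.
apply/entails_uncurry/(entails_trans bb')/entails_curry.
exact: entails_conjC.
Qed.

Lemma entails_imp a b a' b' :
  entails a' a -> entails b b' -> entails (a ==> b) (a' ==> b').
Proof.
move=> a'a bb'; apply/entails_curry/(entails_trans (entails_conjC _ _)).
apply: entails_trans bb'; apply: entails_trans (entails_modus_ponens a b).
exact: entails_conj.
Qed.

Lemma conjA_entails a b c : entails (a &* (b &* c)) (a &* b &* c).
Proof.
apply/entails_uncurry.
apply: (@entails_trans (b ==> (c ==> a &* b &* c))); last exact/axE/ax_uncurry.
by do 2!apply/entails_curry.
Qed.

Lemma entails_conjA a b c : entails (a &* b &* c) (a &* (b &* c)).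
Proof.
do 2!apply/entails_uncurry.
apply: (@entails_trans (b &* c ==> a &* (b &* c))); last exact/axE/ax_curry.
exact/entails_curry.
Qed.

(** For theorems, [&] behaves as a conjunction although [a] does not entail
    [a & a]: theorems may be used repeatedly. *)
Lemma provable_conj a b :
  provable T (a &* b)%F <-> provable T a /\ provable T b.
Proof.
split=> [ab|[Ta Tb]].
  by split; apply: provable_mp ab _;
    [apply: entails_conj_l | apply: entails_conj_r].
apply: provable_mp Tb _; apply: provable_mp Ta _.
exact/entails_curry.
Qed.

Lemma provable_iff a b :
  provable T (a <==> b)%F <-> entails a b /\ entails b a.
Proof. exact: provable_conj. Qed.

(** The axiom of prelinearity read as a rule of proof by cases. *)
Lemma provable_cases a b c :
  entails (a ==> b) c -> entails (b ==> a) c -> provable T c.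
Proof.
move=> abc bac; apply: provable_mp bac _; apply: provable_mp abc _.
exact/provable_axiom/ax_prelin.
Qed.

Lemma entails_meet_l a b : entails (a `&` b) a.
Proof. exact/axE/ax_meetl. Qed.

Lemma entails_meetC a b : entails (a `&` b) (b `&` a).
Proof. exact/axE/ax_meetC. Qed.

Lemma entails_meet_r a b : entails (a `&` b) b.
Proof. exact: entails_trans (entails_meetC a b) (entails_meet_l b a). Qed.

(** Divisibility [a & (a => b) => a /\ b] reads [(a => b) => (a => a /\ b)]:
    when [a => b], a lower bound of [a] is one of the meet; symmetrically when
    [b => a]. *)
Lemma entails_meet a b c :
  entails c (a `&` b) <-> entails c a /\ entails c b.
Proof.
split=> [cab|[ca cb]].
  by split; apply: entails_trans cab _;
    [apply: entails_meet_l | apply: entails_meet_r].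
have div x y : entails (x ==> y) (x ==> (x `&` y)).
  apply/entails_curry/(entails_trans (entails_conjC _ _)).
  exact/axE/ax_div.
apply: (@provable_cases a b).
- by apply: entails_trans (div a b) _; apply: entails_imp.
- apply: entails_trans (div b a) _; apply: entails_imp => //.
  exact: entails_meetC.
Qed.

Definition Join a b : formula V :=
  (((a ==> b) ==> b) `&` ((b ==> a) ==> a))%F.

(** Each conjunct of [Join a b] is above [a] and [b]; moreover [Join a b]
    gives [b] when [a => b], and [a] when [b => a], hence in both cases any
    common consequence of [a] and [b]. *)
Lemma join_entails a b c :
  entails (Join a b) c <-> entails a c /\ entails b c.
Proof.
have upl x y : entails x ((x ==> y) ==> y).
  exact/entails_curry/entails_modus_ponens.
have upr x y : entails y ((x ==> y) ==> y).
  exact/entails_curry/entails_conj_l.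
split=> [jc|[ac bc]].
  by split; apply: entails_trans jc; apply/entails_meet; split.
(* As [Join] is not syntactically symmetric, its relevant conjunct is a
   hypothesis here: case 1 is (x, y) = (a, b), case 2 is (x, y) = (b, a). *)
have case_imp x y : entails y c -> entails (Join a b) ((x ==> y) ==> y) ->
    entails (x ==> y) (Join a b ==> c).
  move=> yc jxy; apply/entails_curry/(entails_trans (entails_conjC _ _)).
  exact/(entails_trans _ yc)/entails_uncurry.
apply: (@provable_cases a b); apply: case_imp => //.
- exact: entails_meet_l.
- exact: entails_meet_r.
Qed.

(** [Join (a => b) (b => a)] follows from [a => b] as well as from
    [b => a]. *)
Lemma provable_join_imp a b : provable T (Join (a ==> b) (b ==> a)).
Proof.
have [] := (join_entails (a ==> b) (b ==> a) _).1 (entails_refl _).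
exact: provable_cases.
Qed.

(** By (M1), [box a => b] is a theorem; necessitation boxes it, and (M3)
    distributes that box over the implication. *)
Lemma entails_box a b : entails a b -> entails (Box a) (Box b).
Proof.
move=> ab; have bab : entails (Box a) b.
  by apply: entails_trans ab; apply/axE/ax_M1.
have [M3 _] := (provable_iff _ _).1 (provable_axiom T (ax_M3 a b)).
exact: provable_mp (provable_nec bab) M3.
Qed.

End Entailment.

#[local] Hint Resolve entails_refl : core.

(** * The Lindenbaum algebra *)

Section Lindenbaum.
Variables (V : Type) (T : theory V).
Implicit Types a b c : formula V.

Definition interderivable a b : bool := `[< provable T (a <==> b)%F >].

Lemma interderivableP a b :
  reflect (entails T a b /\ entails T b a) (interderivable a b).
Proof. by apply: (equivP (asboolP _)); apply: provable_iff. Qed.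

Lemma interderivable_refl : reflexive interderivable.
Proof. by move=> a; apply/interderivableP. Qed.

Lemma interderivable_sym : symmetric interderivable.
Proof. by move=> a b; apply/interderivableP/interderivableP => -[]. Qed.

Lemma interderivable_trans : transitive interderivable.
Proof.
move=> b a c /interderivableP [ab ba] /interderivableP [bc cb].
apply/interderivableP.
by split; [apply: entails_trans ab bc | apply: entails_trans cb ba].
Qed.

Canonical interderivable_equiv := EquivRel interderivable
  interderivable_refl interderivable_sym interderivable_trans.

(** The algebra lives on a quotient type with canonical representatives, so
    that every operation on formulas lifts to it, and respects classes as soon
    as it is monotone or antitone in each argument for [entails]. *)
Definition lindenbaum := {eq_quot interderivable}.

HB.instance Definition _ := Choice.on lindenbaum.
HB.instance Definition _ := EqQuotient.on lindenbaum.

Lemma lindenbaum_eqP a b :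
  (\pi_lindenbaum a = \pi b) <-> (entails T a b /\ entails T b a).
Proof.
by split=> [/eqmodP/interderivableP|?]; last exact/eqmodP/interderivableP.
Qed.

Lemma entails_repr a :
  entails T (repr (\pi_lindenbaum a)) a /\
  entails T a (repr (\pi_lindenbaum a)).
Proof. by apply/lindenbaum_eqP; rewrite reprK. Qed.

Definition lind_conj := lift_op2 lindenbaum (@Conj V).
Definition lind_imp := lift_op2 lindenbaum (@Imp V).
Definition lind_meet := lift_op2 lindenbaum (@Meet V).
Definition lind_join := lift_op2 lindenbaum (@Join V).
Definition lind_box := lift_op1 lindenbaum (@Box V).
Definition lind_le (x y : lindenbaum) : bool :=
  `[< entails T (repr x) (repr y) >].

Lemma pi_conj : {morph \pi_lindenbaum : a b / Conj a b >-> lind_conj a b}.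
Proof.
move=> a b; unlock lind_conj; apply/lindenbaum_eqP.
have [[a1 a2] [b1 b2]] := (entails_repr a, entails_repr b).
by split; apply: entails_conj.
Qed.

Lemma pi_imp : {morph \pi_lindenbaum : a b / Imp a b >-> lind_imp a b}.
Proof.
move=> a b; unlock lind_imp; apply/lindenbaum_eqP.
have [[a1 a2] [b1 b2]] := (entails_repr a, entails_repr b).
by split; apply: entails_imp.
Qed.

Lemma pi_meet : {morph \pi_lindenbaum : a b / Meet a b >-> lind_meet a b}.
Proof.
have meet_mono a b a' b' : entails T a a' -> entails T b b' ->
    entails T (a `&` b) (a' `&` b').
  move=> aa' bb'; apply/entails_meet; split.
  - exact: entails_trans (entails_meet_l _ _ _) aa'.
  - exact: entails_trans (entails_meet_r _ _ _) bb'.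
move=> a b; unlock lind_meet; apply/lindenbaum_eqP.
have [[a1 a2] [b1 b2]] := (entails_repr a, entails_repr b).
by split; apply: meet_mono.
Qed.

Lemma pi_join : {morph \pi_lindenbaum : a b / Join a b >-> lind_join a b}.
Proof.
by move=> a b; unlock lind_join; rewrite /Join !(pi_meet, pi_imp) !reprK.
Qed.

Lemma pi_box : {morph \pi_lindenbaum : a / Box a >-> lind_box a}.
Proof.
move=> a; unlock lind_box; apply/lindenbaum_eqP.
by have [a1 a2] := entails_repr a; split; apply: entails_box.
Qed.

Lemma pi_le a b : reflect (entails T a b) (lind_le (\pi a) (\pi b)).
Proof.
have [[a1 a2] [b1 b2]] := (entails_repr a, entails_repr b).
apply: (iffP (asboolP _)) => ab.
- exact: entails_trans (entails_trans a2 ab) b1.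
- exact: entails_trans (entails_trans a1 ab) b2.
Qed.

Lemma lind_le_refl : reflexive lind_le.
Proof. by move=> x; apply/asboolP. Qed.

Lemma lind_le_anti : antisymmetric lind_le.
Proof.
elim/quotW=> a; elim/quotW=> b /andP [/pi_le ab /pi_le ba].
exact/lindenbaum_eqP.
Qed.

Lemma lind_le_trans : transitive lind_le.
Proof.
by move=> y x z /asboolP xy /asboolP yz; apply/asboolP/(entails_trans xy).
Qed.

HB.instance Definition _ := Order.Le_isPOrder.Build (Order.Disp tt tt)
  lindenbaum lind_le_refl lind_le_anti lind_le_trans.

Lemma lind_leE a b :
  reflect (entails T a b) (\pi_lindenbaum a <= \pi_lindenbaum b).
Proof. exact: pi_le. Qed.

Lemma lind_lexI (x y z : lindenbaum) :
  (x <= lind_meet y z) = (x <= y) && (x <= z).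
Proof.
elim/quotW: x => c; elim/quotW: y => a; elim/quotW: z => b.
rewrite -pi_meet; apply/lind_leE/andP => [/entails_meet[ca cb]|].
  by split; apply/lind_leE.
by move=> [/lind_leE ca /lind_leE cb]; apply/entails_meet.
Qed.

Lemma lind_leUx (x y z : lindenbaum) :
  (lind_join x y <= z) = (x <= z) && (y <= z).
Proof.
elim/quotW: x => a; elim/quotW: y => b; elim/quotW: z => c.
rewrite -pi_join; apply/lind_leE/andP => [/join_entails[ac bc]|].
  by split; apply/lind_leE.
by move=> [/lind_leE ac /lind_leE bc]; apply/join_entails.
Qed.

Lemma lind_le0x (x : lindenbaum) : \pi_lindenbaum Zero <= x.
Proof.
by elim/quotW: x => a; apply/lind_leE/provable_axiom/ax_zero.
Qed.

Lemma lind_lex1 (x : lindenbaum) : x <= \pi_lindenbaum (One Zero).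
Proof. by elim/quotW: x => a; apply/lind_leE/entails_provable/entails_refl. Qed.

HB.instance Definition _ :=
  Order.POrder_isMeetSemilattice.Build _ lindenbaum lind_lexI.
HB.instance Definition _ :=
  Order.POrder_isJoinSemilattice.Build _ lindenbaum lind_leUx.
HB.instance Definition _ := Order.hasBottom.Build _ lindenbaum lind_le0x.
HB.instance Definition _ := Order.hasTop.Build _ lindenbaum lind_lex1.

Lemma pi_eq_top a : \pi_lindenbaum a = \top <-> provable T a.
Proof.
rewrite -[\top]/(\pi_lindenbaum (One Zero)) lindenbaum_eqP.
split=> [[_]|Ta]; first exact/provable_mp/entails_refl.
by split; apply: entails_provable => //; apply: entails_refl.
Qed.

Lemma lind_conjA : associative lind_conj.
Proof.
elim/quotW=> a; elim/quotW=> b; elim/quotW=> c.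
rewrite -!pi_conj; apply/lindenbaum_eqP.
by split; [apply: conjA_entails | apply: entails_conjA].
Qed.

Lemma lind_conjC : commutative lind_conj.
Proof.
elim/quotW=> a; elim/quotW=> b; rewrite -!pi_conj; apply/lindenbaum_eqP.
by split; apply: entails_conjC.
Qed.

Lemma lind_conj1x : left_id (\top : lindenbaum) lind_conj.
Proof.
elim/quotW=> a; rewrite -[\top]/(\pi_lindenbaum (One Zero)) -pi_conj.
apply/lindenbaum_eqP; split; first exact: entails_conj_r.
have TOne : provable T (One Zero) by apply: entails_refl.
by apply: provable_mp TOne _; apply/entails_curry.
Qed.

Lemma lind_residuation (x y z : lindenbaum) :
  lind_conj x y <= z <-> x <= lind_imp y z.
Proof.
elim/quotW: x => a; elim/quotW: y => b; elim/quotW: z => c.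
rewrite -pi_conj -pi_imp.
by split=> /lind_leE ?; apply/lind_leE;
  [apply: entails_curry | apply: entails_uncurry].
Qed.

Lemma lind_prelinearity (x y : lindenbaum) :
  lind_imp x y `|` lind_imp y x = \top.
Proof.
elim/quotW: x => a; elim/quotW: y => b; rewrite -!pi_imp.
rewrite -[_ `|` _]/(lind_join _ _) -pi_join.
exact/pi_eq_top/provable_join_imp.
Qed.

HB.instance Definition _ := TBLattice_isMTL.Build _ lindenbaum
  lind_conjA lind_conjC lind_conj1x lind_residuation lind_prelinearity.

Lemma pi_eq_axiom a b :
  mmtl_axiom (a <==> b)%F -> \pi_lindenbaum a = \pi_lindenbaum b.
Proof. by move=> ax; apply/lindenbaum_eqP/provable_iff/provable_axiom. Qed.

Lemma lind_U1 (x : lindenbaum) : lind_box x <= x.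
Proof.
elim/quotW: x => a; rewrite -pi_box; apply/lind_leE.
exact/provable_axiom/ax_M1.
Qed.

Lemma lind_U2 (x y : lindenbaum) :
  lind_box (mtl_imp (mtl_imp x (lind_box y)) (lind_box y)) =
  mtl_imp (mtl_imp (lind_box x) (lind_box y)) (lind_box y).
Proof.
elim/quotW: x => a; elim/quotW: y => b; rewrite -[mtl_imp]/lind_imp.
rewrite -!(pi_box, pi_imp); exact/pi_eq_axiom/ax_M2.
Qed.

Lemma lind_U3 (x y : lindenbaum) :
  lind_box (mtl_imp (lind_box x) y) = mtl_imp (lind_box x) (lind_box y).
Proof.
elim/quotW: x => a; elim/quotW: y => b; rewrite -[mtl_imp]/lind_imp.
rewrite -!(pi_box, pi_imp); exact/pi_eq_axiom/ax_M3.
Qed.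

HB.instance Definition _ :=
  MTL_isUMTL.Build _ lindenbaum lind_U1 lind_U2 lind_U3.

Lemma pi_is_model : is_model T (fun a => \pi_lindenbaum a).
Proof.
split; last by move=> c Tc; apply/pi_eq_top/provable_hyp.
by split=> *; rewrite ?(pi_conj, pi_imp, pi_meet, pi_box).
Qed.

End Lindenbaum.

Theorem theorem5p2 (V : Type) (T : theory V) (a b : formula V) :
  [<-> provable T a;
       forall (d : Order.disp_t) (L : umtlAlgType d) (e : formula V -> L),
         is_model T e -> e a = \top;
       lt_class T a = lt_class T (One b)].
Proof.
have TOne : provable T (One b) by apply: entails_refl.
tfae.
- by move=> Ta d L e [ev_e eT]; apply: soundness Ta.
- move=> val_a.
  have Ta : provable T a by apply/pi_eq_top/val_a/pi_is_model.
  apply/seteqP; split=> c /provable_iff [h _].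
  + have Tc := provable_mp Ta h.
    by apply/provable_iff; split; apply: entails_provable.
  + have Tc := provable_mp TOne h.
    by apply/provable_iff; split; apply: entails_provable.
- move=> eq_class.
  have : lt_class T (One b) (One b) by apply/provable_iff.
  by rewrite -eq_class => /provable_iff [_]; apply: provable_mp.
Qed.
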